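(* Let $G$ be a multi-orientable three-dimensional GFT graph. (i) If $G$ has exactly two external legs, they do not both carry the label $+$ and do not both carry the label $-$ (no two-point function of type $\phi\phi$ or $\bar\phi\bar\phi$). (ii) If $G$ has exactly four external legs, then two of them carry the label $+$ and two carry the label $-$ (no four-point function of a type other than $\phi\bar\phi\phi\bar\phi$). This holds at any order of perturbation theory, i.e. for graphs with any number of vertices.
   Context: A three-dimensional GFT graph is a graph with 4-valent vertices, each edge consisting of three strands joined without twists, with strand connections at vertices given by the Boulatov vertex; it may have external legs (unpaired half-edges). A GFT graph is multi-orientable if each half-edge (including external legs) can be labeled $+$ or $-$ so that at every vertex there are two $+$ and two $-$ half-edges alternating in the cyclic order ($+,-,+,-$), and every internal edge joins a $-$ half-edge to a $+$ half-edge. These graphs are the Feynman graphs of the action $S[\phi]=\frac12\int\bar\phi\phi+\frac{\lambda}{4!}\int\bar\phi\phi\bar\phi\phi$ for a complex field $\phi$ on $SU(2)^3$, where $\bar\phi$ and $\phi$ correspond to the two labels; the type of an external leg is the field ($\phi$ or $\bar\phi$) attached to it. *)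

(* Defs.v *)
From HB Require Import structures.
From mathcomp Require Import all_boot.
Set Implicit Arguments.
Unset Strict Implicit.
Unset Printing Implicit Defensive.

(* Strand connections of the Boulatov vertex
     phi(g1,g2,g3) phi(g3,g4,g5) phi(g5,g2,g6) phi(g6,g4,g1).
   (i, s) is strand s of the i-th half-edge; half-edges and strands are both
   listed in the cyclic order of the planar drawing of the vertex.  The last
   strand of half-edge i is the first strand of half-edge i+1, and the middle
   strands of opposite half-edges are joined. *)
Definition boulatov (x : 'I_4 * 'I_3) : 'I_4 * 'I_3 :=
  let: (i, s) := x in
  (match val s with
   | 0 => ord_pred i
   | 1 => ordS (ordS i)
   | _ => ordS i
   end, rev_ord s).

Lemma boulatovK : involutive boulatov.
Proof.
by case=> [[[|[|[|[|]]]] // ?] [[|[|[|]]] // ?]]; congr pair; apply: val_inj.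
Qed.

(* The half-edges of a graph with vertex set V are the pairs (v, i), with i the
   position of the half-edge in the cyclic order at v.  [mate] exchanges the
   two half-edges of each internal edge; its fixed points are the unpaired
   half-edges, i.e. the external legs.  [vertex_strand] and [edge_strand]
   connect strands inside a vertex and along an edge.  Graphs may be
   disconnected, and may have multiple edges and self-loops. *)
Record gft_graph := GFTGraph {
  vertex : finType;
  mate : vertex * 'I_4 -> vertex * 'I_4;
  vertex_strand : (vertex * 'I_4) * 'I_3 -> (vertex * 'I_4) * 'I_3;
  edge_strand : (vertex * 'I_4) * 'I_3 -> (vertex * 'I_4) * 'I_3;
  mateK : involutive mate;
  vertex_strandE : forall v i s,
    vertex_strand ((v, i), s) =
      ((v, (boulatov (i, s)).1), (boulatov (i, s)).2);
  (* Strands are numbered in the cyclic order at each end of the edge, so three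
     parallel (untwisted) strands join s to 2 - s. *)
  edge_strandE : forall h s, mate h != h ->
    edge_strand (h, s) = (mate h, rev_ord s);
  edge_strand_ext : forall h s, mate h = h -> edge_strand (h, s) = (h, s)
}.

Definition half_edge (G : gft_graph) : finType := (vertex G * 'I_4)%type.

Definition external_legs (G : gft_graph) : {set half_edge G} :=
  [set h | mate h == h].

Definition label : finType := bool.
Definition lplus : label := true.
Definition lminus : label := false.

Definition alternating_at (G : gft_graph) (l : half_edge G -> label)
    (v : vertex G) : Prop :=
  [/\ #|[set i : 'I_4 | l (v, i) == lplus]| = 2,
      #|[set i : 'I_4 | l (v, i) == lminus]| = 2
    & forall i : 'I_4, l (v, ordS i) != l (v, i)].

Definition multi_orientation (G : gft_graph) (l : half_edge G -> label) : Prop :=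
  (forall v : vertex G, alternating_at l v) /\
  (forall h : half_edge G, mate h != h ->
     (l h = lminus /\ l (mate h) = lplus) \/ (l h = lplus /\ l (mate h) = lminus)).

Definition multi_orientable (G : gft_graph) : Prop :=
  exists l : half_edge G -> label, multi_orientation l.

Definition legs_labeled (G : gft_graph) (l : half_edge G -> label) (a : label) :
    {set half_edge G} :=
  [set h in external_legs G | l h == a].

(* Main.v *)
(* Each vertex carries as many + as - half-edges, and [mate] exchanges the +
   and the - internal half-edges; hence there are as many + as - external
   legs. *)
Require Import Defs.
From mathcomp Require Import all_boot.

(** Double counting: alternation puts each label on exactly twice as many half-edges as there are
    vertices ([card_labeled]), and internal edges pair + with - ([card_internal_labeled]).
    Subtracting, + and - legs are equally many ([card_legs_labeled]), so two legs split 1+1 and four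
    split 2+2, for any number of vertices. *)

Lemma card_labeled (G : gft_graph) (l : half_edge G -> label) (a : label) :
  (forall v, alternating_at l v) -> #|[set h | l h == a]| = #|vertex G| * 2.
Proof.
move=> alt_l; rewrite -sum1_card.
have -> : \sum_(h in [set h | l h == a]) 1
        = \sum_(v : vertex G) \sum_(i : 'I_4 | l (v, i) == a) 1.
  by rewrite pair_big_dep; apply: eq_bigl => -[v i]; rewrite inE.
rewrite -sum_nat_const; apply: eq_bigr => v _.
by case: (alt_l v) a => plus2 minus2 _ [];
  [rewrite -[RHS]plus2 | rewrite -[RHS]minus2]; rewrite -sum1_card;
  apply: eq_bigl => i; rewrite inE.
Qed.

(** [mate] is an involution without fixed points off the legs, and there it flips the label. *)
Lemma card_internal_labeled (G : gft_graph) (l : half_edge G -> label) :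
  multi_orientation l ->
  #|[set h | l h == lplus] :\: external_legs G|
    = #|[set h | l h == lminus] :\: external_legs G|.
Proof.
move=> [_ mate_l]; rewrite -(card_imset _ (inv_inj (@mateK G))).
apply: eq_card => h; rewrite -[in LHS](mateK h) mem_imset; last first.
  exact: inv_inj (@mateK G).
rewrite !inE mateK eq_sym.
by case: eqVneq => //= /mate_l [] [-> ->].
Qed.

Lemma card_legs_labeled (G : gft_graph) (l : half_edge G -> label) :
  multi_orientation l -> #|legs_labeled l lplus| = #|legs_labeled l lminus|.
Proof.
move=> hl; have legsE a :
    legs_labeled l a = [set h | l h == a] :&: external_legs G.
  by apply/setP => h; rewrite !inE andbC.
(* Add the internal + half-edges to both sides and trade them for the internal - ones on the right:
   each side then counts all half-edges of one label. *)
apply: (@addIn #|[set h | l h == lplus] :\: external_legs G|).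
rewrite [in RHS]card_internal_labeled // !legsE !cardsID.
by case: hl => alt_l _; rewrite !card_labeled.
Qed.

Lemma card_external_legs (G : gft_graph) (l : half_edge G -> label) :
  #|external_legs G| = #|legs_labeled l lplus| + #|legs_labeled l lminus|.
Proof.
rewrite -(cardsID [set h | l h == lplus] (external_legs G)).
by congr (_ + _); apply: eq_card => h; rewrite !inE; case: (l h);
  rewrite ?andbT ?andbF.
Qed.

Theorem theorem5p1 (G : gft_graph) (hG : multi_orientable G)
    (l : half_edge G -> label) (hl : multi_orientation l) :
  (#|external_legs G| = 2 ->
     ~ (forall h : half_edge G, h \in external_legs G -> l h = lplus) /\
     ~ (forall h : half_edge G, h \in external_legs G -> l h = lminus)) /\
  (#|external_legs G| = 4 ->
     #|legs_labeled l lplus| = 2 /\ #|legs_labeled l lminus| = 2).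
Proof.
rewrite (card_external_legs G l) (card_legs_labeled G l hl) addnn.
(* The number of legs is now twice the number of - legs; 2 and 4 convert to [1.*2] and [2.*2]. *)
split=> [/(@double_inj _ 1) minus1 | /(@double_inj _ 2) -> //].
have leg_labeled a : #|legs_labeled l a| = 1 ->
    exists2 h, h \in external_legs G & l h = a.
  move/eqP/cards1P=> [h legs_h]; exists h; have := set11 h;
    by rewrite -legs_h inE => /andP[// _ /eqP].
split=> all_a.
  by have [h /all_a ->] := leg_labeled lminus minus1.
have plus1 : #|legs_labeled l lplus| = 1 by rewrite card_legs_labeled.
by have [h /all_a ->] := leg_labeled lplus plus1.
Qed.
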